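(* For every integer $n\ge 1$ one has $$\operatorname{EGZ}(5,\mathbb{F}_5^n,4)\le 480\,(1+\vartheta_5)^n+1,\qquad 1+\vartheta_5\approx 4.9556902<5 .$$ Moreover, every strongly $e_4$-free subset of $\mathbb{F}_5^n$ of length five has cardinality at most $$5\,(1+\eta_{5,5})^n,\qquad 1+\eta_{5,5}\approx 4.2563617<5 .$$
   Context: The elementary symmetric polynomial is $e_m(x_1,\dots,x_t)=\sum_{1\le i_1<\cdots<i_m\le t}x_{i_1}\cdots x_{i_m}$; it is applied to vectors of $\mathbb{F}_q^n$ coordinatewise (i.e. $\mathbb{F}_q^n$ is a ring with coordinatewise operations). $\operatorname{EGZ}(t,\mathbb{F}_q^n,m)$ is the least integer $\ell$ such that every sequence of length at least $\ell$ of elements of $\mathbb{F}_q^n$ (repeated values allowed) contains a subsequence of length $t$ (i.e. $t$ terms with distinct indices) on which $e_m$ vanishes, i.e. $e_m=0$ in every coordinate. A set $A\subseteq\mathbb{F}_q^n$ is strongly $e_m$-free of length $t$ if whenever $x^{(1)},\dots,x^{(t)}\in A$ (not necessarily distinct) satisfy $e_m(x^{(1)},\dots,x^{(t)})=0$ coordinatewise, then $x^{(1)}=\cdots=x^{(t)}$. The constants are $$\vartheta_q=\inf_{0<\rho<1}(1+\rho+\cdots+\rho^{q-2})\rho^{-(q-1)/3},\qquad \eta_{q,p}=\inf_{0<\rho<1}(1+\rho+\cdots+\rho^{q-2})\rho^{-(q-1)/p},$$ so $\vartheta_5=\inf_{0<\rho<1}(1+\rho+\rho^2+\rho^3)\rho^{-4/3}$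 and $\eta_{5,5}=\inf_{0<\rho<1}(1+\rho+\rho^2+\rho^3)\rho^{-4/5}$. *)

(* Defs.v *)
From HB Require Import structures.
From mathcomp Require Import all_boot all_order all_algebra.
From mathcomp Require Import all_classical all_reals all_analysis.
(* Not imported: the notations of mpoly clash with those of mathcomp-analysis. *)
From mathcomp Require mpoly.

Set Implicit Arguments.
Unset Strict Implicit.
Unset Printing Implicit Defensive.
Import Order.TTheory GRing.Theory Num.Theory.

Local Open Scope ring_scope.

Definition esym (F : comNzRingType) (n t m : nat) (x : 'I_t -> 'rV[F]_n) :
    'rV[F]_n :=
  \row_j mpoly.meval (fun i => x i ord0 j) (mpoly.mesym t F m).

Lemma esymE (F : comNzRingType) (n t m : nat) (x : 'I_t -> 'rV[F]_n) j :
  esym m x ord0 j =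
  \sum_(h : {set 'I_t} | #|h| == m) \prod_(i in h) x i ord0 j.
Proof.
rewrite mxE /mpoly.mesym; set v := fun i => _.
rewrite (big_morph _ (mpoly.mevalD v) (mpoly.meval0 v)).
apply: eq_bigr => h _.
rewrite (big_morph _ (mpoly.mevalM v) (mpoly.meval1 v)).
by apply: eq_bigr => i _; rewrite mpoly.mevalXU.
Qed.

(* Since [esym] is symmetric, a subsequence of length [t] can be given as an
   injective, not necessarily increasing, choice of indices. *)
Definition EGZ_bound (F : comNzRingType) (t n m l : nat) : Prop :=
  forall k, (l <= k)%N -> forall s : 'I_k -> 'rV[F]_n,
    exists2 f : 'I_t -> 'I_k, injective f & esym m (s \o f) = 0.

Definition is_EGZ (F : comNzRingType) (t n m l : nat) : Prop :=
  EGZ_bound F t n m l /\ forall l', EGZ_bound F t n m l' -> (l <= l')%N.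

Definition strongly_free (F : finFieldType) (n t m : nat) (A : {set 'rV[F]_n}) :
    Prop :=
  forall x : 'I_t -> 'rV[F]_n, (forall i, x i \in A) -> esym m x = 0 ->
    forall i j, x i = x j.

Definition growth_const (R : realType) (q d : nat) : R :=
  inf [set (\sum_(i < q.-1) rho ^+ i) * rho `^ (- (q.-1%:R / d%:R))
      | rho in [set rho : R | 0 < rho < 1]]%classic.

Definition vartheta_q (R : realType) (q : nat) : R := growth_const R q 3.

Definition eta_qp (R : realType) (q p : nat) : R := growth_const R q p.

(* Main.v *)
Require Import Defs.
From HB Require Import structures.
From mathcomp Require Import all_boot all_order all_algebra.
From mathcomp Require Import all_classical all_reals all_analysis.
From mathcomp Require finfield.
From mathcomp Require Import ring lra.

Set Implicit Arguments.
Unset Strict Implicit.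
Unset Printing Implicit Defensive.
Import Order.TTheory GRing.Theory Num.Theory.

Local Open Scope ring_scope.

(** The proof combines slice rank with a decomposition by supports.  If
    x_1, ..., x_5 have the same support S, then e_4 vanishes at them as soon as
    the inverses of their entries sum to zero in every coordinate of S: in such a
    coordinate e_4 is the product of the five entries times the sum of their
    inverses, and in the other coordinates all terms contain a zero.
    So the members of a family that have support S give, after entrywise
    inversion, a family of vectors with nonzero entries indexed by S, in which
    zero-sum quintuples are restricted.  If such a family has at most C * c^|S|
    members for every S, the whole family has at most
    C * sum_S c^|S| = C * (1 + c)^n members.

    The bound for one support follows from the partition rank method.  A tensor
    on k-tuples is split into products of two functions that depend on disjoint
    nonempty sets of coordinates.  A tensor that vanishes off the diagonal and is
    nonzero at N diagonal points needs at least N such products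
    ([partition_rank_diagonal]).  On the other hand, the indicator of zero-sum
    tuples is the product over coordinates c of 1 - (sum_i x_i(c))^(q - 1).
    After expansion into monomials, in each monomial one of the variables carries
    at most its share of the total degree.  Grouping by that variable and its
    exponents, which may be reduced modulo q - 1 because the entries are nonzero,
    gives few products ([zero_sum_decomposition]).

    For strongly free sets this applies directly with five variables, since the
    indicator of zero-sum quintuples is the diagonal tensor.  When only quintuples
    with distinct entries are excluded, the indicator is multiplied by a
    combination, over the set partitions of the five positions with at least
    three blocks, of the tensors that test whether a tuple is constant on the
    blocks.  With coefficients from the Moebius function of the partition lattice
    the full combination would be the indicator of tuples with distinct entries;
    omitting the partitions with one and two blocks makes the diagonal values
    nonzero modulo 5 and changes nothing else on zero-sum tuples, because a
    zero-sum quintuple with exactly two values does not exist in characteristic 5.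
    A partition with r >= 3 blocks ties the variables into r groups and costs r
    times a number of exponent vectors of degree at most 4|S|/3.  The total number
    of blocks is 25 * 3 + 10 * 4 + 5 = 120, and a sequence without a zero of e_4
    repeats each value at most four times, hence 480.

    The two constants are estimated after the substitution rho = s^d, which turns
    the function to be minimised into s^-4 (1 + s^d + s^2d + s^3d), a sum of
    integer powers.  A near-minimal s gives the upper bound, and the tangent line
    at that s, by Bernoulli's inequality for each power, the lower bound. *)

(** * Exponent vectors of bounded degree and the growth constant *)

Definition bounded_exps (J : finType) (m d : nat) : {set {ffun J -> 'I_m}} :=
  [set al : {ffun J -> 'I_m} | (d * \sum_c al c <= m * #|J|)%N].

Lemma bounded_exps_sub (J : finType) (m d d' : nat) :
  (d <= d')%N -> (#|bounded_exps J m d'| <= #|bounded_exps J m d|)%N.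
Proof.
move=> dd'; apply/subset_leq_card/fintype.subsetP => al; rewrite !inE.
by apply: leq_trans; rewrite leq_mul2r dd' orbT.
Qed.

(** Chernoff-type bound: in the expansion of (sum_i s^(d i))^|J| over exponent
    vectors, each vector counted here contributes at least s^(m |J|). *)
Lemma card_bounded_exps_le (R : realFieldType) (J : finType) (m d : nat) (s : R) :
  0 < s < 1 ->
  #|bounded_exps J m d|%:R <=
    ((\sum_(i < m) (s ^+ d) ^+ i) * s ^- m) ^+ #|J|.
Proof.
case/andP=> s0 s1.
rewrite exprMn exprVn -exprM ler_pdivlMr ?exprn_gt0//.
have -> : (\sum_(i < m) (s ^+ d) ^+ i) ^+ #|J| =
    \sum_(al : {ffun J -> 'I_m}) s ^+ (d * \sum_c al c).
  rewrite -prodr_const bigA_distr_bigA; apply: eq_bigr => al _.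
  under eq_bigr do rewrite -exprM.
  by rewrite big_distrr/= -expr_sum.
rewrite mulr_natl -sumr_const [leRHS](bigID (mem (bounded_exps J m d)))/=.
rewrite ler_wpDr//; first by apply: sumr_ge0 => al _; rewrite exprn_ge0// ltW.
apply: ler_sum => al; rewrite inE => h.
by rewrite ler_wiXn2l// ltW.
Qed.

Lemma powR_root_expn (R : realType) (m d : nat) (s : R) : (0 < d)%N -> 0 < s ->
  (s ^+ d) `^ (- (m%:R / d%:R)) = s ^- m.
Proof.
move=> d0 s0; rewrite powRN -(powR_mulrn _ (ltW s0)) -powRrM.
rewrite mulrC divfK ?pnatr_eq0 -?lt0n//.
by rewrite powR_mulrn// ltW.
Qed.

Local Open Scope classical_set_scope.

(** Putting rho = s^d replaces the real power in the definition of the constant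
    by an integer power; this lemma and the next one are the two halves of that
    change of variable. *)
Lemma growth_const_le (R : realType) (q d : nat) (s : R) :
  (0 < d)%N -> 0 < s < 1 ->
  growth_const R q d <= (\sum_(i < q.-1) (s ^+ d) ^+ i) * s ^- q.-1.
Proof.
move=> d0 /andP[s0 s1]; apply: ge_inf.
  exists 0 => _ [r /= /andP[r0 r1] <-]; rewrite mulr_ge0 ?powR_ge0//.
  by apply: sumr_ge0 => i _; rewrite exprn_ge0// ltW.
exists (s ^+ d); last by rewrite powR_root_expn.
by rewrite /= exprn_gt0//= exprn_ilt1// ?ltW// -?lt0n.
Qed.

Lemma le_growth_const (R : realType) (q d : nat) (x : R) : (0 < d)%N ->
  (forall s, 0 < s < 1 -> x <= (\sum_(i < q.-1) (s ^+ d) ^+ i) * s ^- q.-1) ->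
  x <= growth_const R q d.
Proof.
move=> d0 h; apply: lb_le_inf.
  exists ((\sum_(i < q.-1) (2^-1 : R) ^+ i) * 2^-1 `^ (- (q.-1%:R / d%:R))).
  exists 2^-1 => //=; rewrite invr_gt0 ltr0n/= invf_lt1 ?ltr1n//.
move=> _ [r /= /andP[r0 r1] <-]; have := h (r `^ (d%:R^-1)).
have rd : (r `^ d%:R^-1) ^+ d = r.
  by rewrite -powR_mulrn ?powR_ge0// -powRrM mulVf ?powRr1 ?ltW// pnatr_eq0 -lt0n.
have rp : 0 < r `^ d%:R^-1 by rewrite powR_gt0.
rewrite rd => h'; rewrite -{2}rd powR_root_expn//; apply: h'.
rewrite rp/= ltNge; apply/negP => h'.
by have := @exprn_ege1 _ d _ h'; rewrite rd leNgt r1.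
Qed.

Local Close Scope classical_set_scope.

Lemma growth_fun_ge0 (R : realFieldType) (m d : nat) (s : R) : 0 < s ->
  0 <= (\sum_(i < m) (s ^+ d) ^+ i) * s ^- m.
Proof.
move=> s0; apply: mulr_ge0; last by rewrite invr_ge0 exprn_ge0// ltW.
by apply: sumr_ge0 => i _; rewrite !exprn_ge0// ltW.
Qed.

Lemma growth_const_ge0 (R : realType) (q d : nat) : (0 < d)%N ->
  0 <= growth_const R q d.
Proof.
move=> d0; apply: le_growth_const => // s /andP[s0 _]; exact: growth_fun_ge0.
Qed.

(** The infimum over rho passes through the power |J| because the |J|-th root of
    the cardinal is below every value of the function. *)
Lemma card_bounded_exps_growth (R : realType) (J : finType) (q d : nat) :
  (0 < d)%N ->
  #|bounded_exps J q.-1 d|%:R <= growth_const R q d ^+ #|J|.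
Proof.
move=> d0; set M := #|_|%:R.
have M0 : (0 : R) <= M by rewrite ler0n.
have h01 : 0 < (2^-1 : R) < 1 by rewrite invr_gt0 ltr0n/= invf_lt1 ?ltr1n.
case: (posnP #|J|) => [J0|J0].
  by have := @card_bounded_exps_le R J q.-1 d _ h01; rewrite J0 !expr0.
have rootE : (M `^ (#|J|%:R^-1)) ^+ #|J| = M.
  by rewrite -powR_mulrn ?powR_ge0// -powRrM mulVf ?powRr1// pnatr_eq0 -lt0n.
rewrite -rootE lerXn2r ?nnegrE ?powR_ge0 ?growth_const_ge0//.
apply: le_growth_const => // s s01.
have g0 := @growth_fun_ge0 R q.-1 d _ (proj1 (andP s01)).
rewrite -(@ler_pXn2r _ #|J|) ?nnegrE ?powR_ge0// rootE.
exact: card_bounded_exps_le.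
Qed.

(** For a negative exponent, apply the inequality to 1/z and use
    z + 1/z >= 2. *)
Lemma bernoulli_inequality (R : realFieldType) (z : R) (k : int) : 0 < z ->
  1 + k%:~R * (z - 1) <= z ^ k.
Proof.
have nonneg (y : R) (n : nat) : 0 <= y -> 1 + n%:R * (y - 1) <= y ^+ n.
  move=> y0; elim: n => [|n IH]; first by rewrite mul0r addr0.
  rewrite exprS -natr1; apply: le_trans (ler_wpM2l y0 IH).
  rewrite -subr_ge0.
  have -> : y * (1 + n%:R * (y - 1)) - (1 + (n%:R + 1) * (y - 1)) =
    n%:R * (y - 1) ^+ 2 by ring.
  by rewrite mulr_ge0// sqr_ge0.
case: k => n z0; first exact/nonneg/ltW.
rewrite NegzE -exprnN -exprVn mulrNz mulNr -mulrN.
apply: le_trans (nonneg _ _ _); last by rewrite invr_ge0 ltW.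
rewrite lerD2l ler_wpM2l//.
rewrite -subr_ge0.
have -> : z^-1 - 1 - - (z - 1) = (z - 1) ^+ 2 / z by field; rewrite gt_eqF.
by rewrite mulr_ge0 ?sqr_ge0// invr_ge0 ltW.
Qed.

(** Each integer power, after rescaling by a, lies above its tangent at 1; so a
    sum of powers lies above its tangent line at a. *)
Lemma sum_powers_tangent_le (R : realFieldType) (ks : seq int) (a s : R) :
  0 < a -> 0 < s ->
  \sum_(k <- ks) a ^ k + (\sum_(k <- ks) k%:~R * a ^ k) * (s / a - 1)
  <= \sum_(k <- ks) s ^ k.
Proof.
move=> a0 s0; rewrite mulr_suml -big_split/=; apply: ler_sum => k _.
rewrite -[X in _ <= X ^ _](divfK (lt0r_neq0 a0)) mulrC expfzMl mulrC.
have -> : a ^ k + (k%:~R * a ^ k) * (s / a - 1) =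
  (1 + k%:~R * (s / a - 1)) * a ^ k by ring.
by rewrite ler_wpM2r ?bernoulli_inequality ?divr_gt0// exprz_ge0// ltW.
Qed.

(** * Numerical values of the growth constants *)

(** Here G / a^4 is the value at s = a of the function to be minimised, and
    D / a^4 is a times its derivative there.  Since |s/a - 1| <= 1 for s in (0, 1)
    and a >= 1/2, the tangent line at a stays above (G - |D|) / a^4, which is
    sharp when a is close to the minimiser. *)
Lemma growth5_bounds (R : realType) (d : nat) (a lo hi : R) :
  let G := 1 + a ^+ d + a ^+ (2 * d) + a ^+ (3 * d) in
  let D := - 4 + (d%:R - 4) * a ^+ d + (2 * d%:R - 4) * a ^+ (2 * d)
           + (3 * d%:R - 4) * a ^+ (3 * d) in
  (0 < d)%N -> 1 <= 2 * a -> a < 1 ->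
  lo * a ^+ 4 + D <= G -> lo * a ^+ 4 - D <= G -> G <= hi * a ^+ 4 ->
  lo <= growth_const R 5 d <= hi.
Proof.
move=> G D d0 a2 a1 hD1 hD2 hhi.
have a0 : 0 < a by lra.
pose ks : seq int := [:: - 4; d%:Z - 4; (2 * d)%:Z - 4; (3 * d)%:Z - 4].
have powE (s : R) (n : nat) : 0 < s -> s ^ (n%:Z - 4) = s ^+ n * s ^- 4.
  by move=> s0; rewrite (expfzDr _ _ (lt0r_neq0 s0)) -exprnN -exprnP.
have sumE (s : R) : 0 < s ->
    (\sum_(i < 4) (s ^+ d) ^+ i) * s ^- 4 = \sum_(k <- ks) s ^ k.
  move=> s0; rewrite !big_ord_recr big_ord0 !big_cons big_nil/= -!exprM.
  rewrite !powE// -exprnN muln0 muln1 (mulnC d 2) (mulnC d 3).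
  by rewrite add0r addr0 !mulrDl expr0 mul1r !addrA.
have a4 : 0 < a ^+ 4 by rewrite exprn_gt0.
apply/andP; split; last first.
  apply: le_trans (@growth_const_le _ _ _ a d0 _) _; first by rewrite a0.
  rewrite /= ler_pdivrMr//; apply: le_trans hhi.
  rewrite !big_ord_recr big_ord0/= -!exprM muln0 muln1 (mulnC d 2) (mulnC d 3).
  by rewrite add0r.
apply: le_growth_const => // s /andP[s0 s1]; rewrite sumE//.
apply: le_trans (sum_powers_tangent_le ks a0 s0).
have -> : \sum_(k <- ks) a ^ k = G / a ^+ 4.
  rewrite -sumE//; congr (_ / _); rewrite !big_ord_recr big_ord0/= -!exprM.
  by rewrite muln0 muln1 (mulnC d 2) (mulnC d 3) add0r.
have -> : \sum_(k <- ks) k%:~R * a ^ k = D / a ^+ 4.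
  rewrite !big_cons big_nil addr0 !powE// -exprnN /D.
  rewrite !intrB !PoszM !intrM/=.
  rewrite -!pmulrn; ring.
rewrite mulrAC -mulrDl ler_pdivlMr//.
have z0 : 0 <= s / a by rewrite divr_ge0 ?ltW.
have z2 : s / a <= 2 by rewrite ler_pdivrMr//; lra.
nra.
Qed.

Lemma vartheta5_bounds (R : realType) :
  3 + 955 / 10 ^+ 3 + 690 / 10 ^+ 6 + 2 / 10 ^+ 7 - 5 / 10 ^+ 8
    <= vartheta_q R 5 <=
  3 + 955 / 10 ^+ 3 + 690 / 10 ^+ 6 + 2 / 10 ^+ 7 + 5 / 10 ^+ 8.
Proof.
(* The witness is the minimiser, the positive root of 5 s^9 + 2 s^6 - s^3 = 4,
   to twelve digits. *)
by apply: (@growth5_bounds _ 3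
    (956 / 10 ^+ 3 + 312 / 10 ^+ 6 + 829 / 10 ^+ 9 + 660 / 10 ^+ 12));
  [exact: isT|lra..].
Qed.

Lemma eta55_bounds (R : realType) :
  3 + 256 / 10 ^+ 3 + 361 / 10 ^+ 6 + 7 / 10 ^+ 7 - 5 / 10 ^+ 8
    <= eta_qp R 5 5 <=
  3 + 256 / 10 ^+ 3 + 361 / 10 ^+ 6 + 7 / 10 ^+ 7 + 5 / 10 ^+ 8.
Proof.
(* The positive root of 11 s^15 + 6 s^10 + s^5 = 4. *)
by apply: (@growth5_bounds _ 5
    (883 / 10 ^+ 3 + 637 / 10 ^+ 6 + 270 / 10 ^+ 9 + 521 / 10 ^+ 12));
  [exact: isT|lra..].
Qed.

(** * Partition rank *)

Section PartitionRank.
Import mathcomp.boot.fintype mathcomp.boot.finset.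
Variables (F : fieldType) (I T : finType).
Implicit Types (P Q K : {set I}) (f g h : (I -> T) -> F).

(** The tensors are functions of a full tuple I -> T throughout; the set K of the
    variables still in play shrinks during the elimination below. *)
Definition depends_on P f := forall x y, {in P, x =1 y} -> f x = f y.

Definition decomposable K h := exists P Q f g,
  [/\ P != set0, Q != set0, [disjoint P & Q], P :|: Q \subset K &
  [/\ depends_on P f, depends_on Q g & forall x, h x = f x * g x]].

Definition slice k K h := exists u g,
  depends_on (K :\ k) g /\ forall x, h x = u (x k) * g x.

Definition upd (x : I -> T) k a i := if i == k then a else x i.

Lemma depends_on_upd P f k x a : k \notin P -> depends_on P f ->
  f (upd x k a) = f x.
Proof.
move=> kP; apply=> i iP; rewrite /upd; case: eqP => // ik.
by rewrite -ik iP in kP.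
Qed.

(** Contracting one variable k against a weight w keeps a product decomposable,
    unless one of the two factors depends on k alone; the factor that does not
    involve k comes out of the sum. *)
Lemma decomposable_sum K h k (w : T -> F) : decomposable K h ->
  slice k K h \/ decomposable (K :\ k) (fun x => \sum_a w a * h (upd x k a)).
Proof.
move=> [P [Q [f [g [P0 Q0 PQ PQK [fP gQ hE]]]]]].
wlog kQ : P Q f g P0 Q0 PQ PQK fP gQ hE / k \notin Q => [H|].
  case: (boolP (k \in Q)) => kQ; last exact: (H P Q f g).
  apply: (H Q P g f) => //; rewrite 1?disjoint_sym 1?setUC//.
  - by move=> x; rewrite hE mulrC.
  - by rewrite (disjointFl PQ kQ).
have [PK QK] := (subset_trans (subsetUl P Q) PQK, subset_trans (subsetUr P Q) PQK).
have QKk : Q \subset K :\ k by rewrite subsetD1 kQ QK.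
have [Pk0|Pk] := eqVneq (P :\ k) set0; [left|right].
  exists (fun a => f (fun=> a)), g; split => [x y xy|x].
    by apply: gQ => i iQ; apply: xy; apply: (subsetP QKk).
  rewrite hE; congr (_ * _); apply: fP => i iP.
  have [->//|ik] := eqVneq i k.
  by have := in_set0 i; rewrite -Pk0 !inE ik iP.
exists (P :\ k), Q, (fun x => \sum_a w a * f (upd x k a)), g; split => //.
- by apply: disjointWl PQ; apply: subsetDl.
- by rewrite subUset setSD.
split => // [x y xy|x].
  apply: eq_bigr => a _; congr (_ * _); apply: fP => i iP.
  by rewrite /upd; case: eqP => // /eqP ik; apply: xy; rewrite !inE ik.
rewrite mulr_suml; apply: eq_bigr => a _.
by rewrite hE (depends_on_upd _ _ kQ gQ) mulrA.
Qed.

(** A space of vectors of dimension r contains a vector with r nonzero entries: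
    choose r coordinates on which a basis restricts to an invertible matrix and
    prescribe the value 1 there.  The space meant here consists of the vectors that
    vanish outside S and are orthogonal to the functions u_l. *)
Lemma orthogonal_large_support (L : finType) (S : {set T}) (B : {set L})
    (u : L -> T -> F) :
  exists w : T -> F, (forall l, l \in B -> \sum_a w a * u l a = 0) /\
    (#|S| <= #|[set a in S | w a != 0%R]| + #|B|)%N.
Proof.
pose U := \matrix_(i < #|S|, j < #|B|) u (enum_val j) (enum_val i).
pose M := row_base (kermx U).
have Mfull : row_full M^T by rewrite /row_full mxrank_tr; apply: row_base_free.
pose e := fullrankfun Mfull.
have Nunit : colsub e M \in unitmx.
  by rewrite -[M]trmxK -trmx_mxsub unitmx_tr fullrowsub_unit.
pose v := const_mx 1 *m invmx (colsub e M) *m M : 'rV_#|S|.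
have ve j : v 0 (e j) = 1.
  have -> : v 0 (e j) = colsub e v 0 j by rewrite [RHS]mxE.
  by rewrite -mulmx_colsub mulmxKV// mxE.
have vU : v *m U = 0.
  rewrite /v -mulmxA; have : (M <= kermx U)%MS by rewrite eq_row_base.
  by rewrite sub_kermx => /eqP ->; rewrite mulmx0.
pose w a := \sum_(i < #|S|) v 0 i * (enum_val i == a)%:R.
have wE i : w (enum_val i) = v 0 i.
  rewrite /w (bigD1 i)//= eqxx mulr1 big1 ?addr0// => j ji.
  by rewrite (inj_eq enum_val_inj) (negbTE ji) mulr0.
exists w; split.
  move=> l lB; have /rowP/(_ (enum_rank_in lB l)) := vU.
  rewrite !mxE => E; rewrite -[RHS]E.
  under eq_bigr do rewrite mulr_suml.
  rewrite exchange_big; apply: eq_bigr => i _.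
  rewrite (bigD1 (enum_val i))//= eqxx mulr1 big1 => [|a ai].
    by rewrite addr0 !mxE enum_rankK_in.
  by rewrite eq_sym (negbTE ai) mulr0 mul0r.
have rk : (#|S| <= \rank (kermx U) + #|B|)%N.
  by rewrite mxrank_ker addnC -leq_subLR leq_sub2l// rank_leq_col.
apply: (leq_trans rk); rewrite leq_add2r.
have einj : injective (fun j => enum_val (e j)).
  by move=> j j' /enum_val_inj/fullrankfun_inj.
rewrite -[X in (X <= _)%N]card_ord -(card_imset _ einj) subset_leq_card//.
apply/subsetP => _ /imsetP[j _ ->].
by rewrite inE enum_valP wE ve oner_eq0.
Qed.

(** Induction on the number of active variables.  To eliminate the variable k,
    contract it against a weight orthogonal to all the factors that depend on k
    alone: those summands disappear, the others stay decomposable, and the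
    diagonal entries that are lost are at most as many as the summands that
    disappeared.  With a single variable left, no summand can exist. *)
Theorem partition_rank_diagonal (L : finType) (h : L -> (I -> T) -> F)
    (i0 : I) (K : {set I}) (B : {set L}) (c : T -> F) :
  i0 \in K -> (forall l, l \in B -> decomposable K (h l)) ->
  (forall x, \sum_(l in B) h l x =
     if [forall i in K, x i == x i0] then c (x i0) else 0) ->
  (#|[set a | c a != 0%R]| <= #|B|)%N.
Proof.
have [n] := ubnP #|K|; elim: n => // n IH in K B h c * => /ltnSE Kn i0K hdec hE.
have [K1|K1] := eqVneq (K :\ i0) set0.
  have B0 : B = set0.
    apply/eqP/set0Pn => -[l /hdec[P [Q [_ [_ [P0 Q0 PQ PQK _]]]]]].
    have KE : K = [set i0] by rewrite -(setD1K i0K) K1 setU0.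
    have only R : R != set0 -> R \subset P :|: Q -> i0 \in R.
      case/set0Pn => r rR /subsetP/(_ _ rR)/(subsetP PQK).
      by rewrite KE inE => /eqP <-.
    have := disjointFl PQ (only _ Q0 (subsetUr P Q)).
    by rewrite (only _ P0) ?subsetUl.
  rewrite B0 cards0 leqn0 cards_eq0; apply/eqP/setP => a; rewrite !inE.
  have := hE (fun=> a); rewrite B0 big_set0 ifT => [E|].
    by rewrite -E eqxx.
  by apply/forallP => i; rewrite eqxx implybT.
have [k kKi] := set0Pn _ K1.
have [ki kK] : k != i0 /\ k \in K by apply/andP; rewrite -in_setD1.
pose B1 := [set l in B | `[< slice k K (h l) >]].
have /choice[u hu] l : exists u : T -> F, l \in B1 -> exists g,
    depends_on (K :\ k) g /\ forall x, h l x = u (x k) * g x.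
  case: (boolP (l \in B1)) => [|_]; last by exists (fun=> 0).
  by rewrite inE => /andP[_ /asboolP[u hu]]; exists u.
have [w [wu wS]] := orthogonal_large_support [set a | c a != 0%R] B1 u.
have B1B : B1 \subset B by apply/subsetP => l; rewrite inE => /andP[].
have K'n : (#|K :\ k| < n)%N by move: Kn; rewrite (cardsD1 k) kK.
have := IH (K :\ k) (B :\: B1) (fun l x => \sum_a w a * h l (upd x k a))
  (fun a => w a * c a) K'n.
rewrite !inE eq_sym ki => /(_ i0K) IHh.
rewrite -(cardsID B1 B) (setIidPr B1B) addnC.
apply: leq_trans wS _; rewrite leq_add2r.
apply: (leq_trans _ (IHh _ _)).
- apply/subset_leq_card/subsetP => a; rewrite !inE mulf_eq0 => /andP[? ?].
  exact/norP.
- move=> l /setDP[lB lB1]; have [sl|//] := decomposable_sum k w (hdec l lB).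
  by case/negP: lB1; rewrite inE lB; apply/asboolP.
move=> x.
have -> : \sum_(l in B :\: B1) \sum_a w a * h l (upd x k a) =
          \sum_(l in B) \sum_a w a * h l (upd x k a).
  rewrite [RHS](big_setID B1)/= (setIidPr B1B) [X in X + _]big1 ?add0r// => l lB1.
  have [g [gK hg]] := hu l lB1.
  transitivity ((\sum_a w a * u l a) * g x); last by rewrite wu ?mul0r.
  rewrite mulr_suml; apply: eq_bigr => a _.
  rewrite hg mulrA {1}/upd eqxx (depends_on_upd _ _ _ gK)//.
  by rewrite !inE eqxx.
rewrite exchange_big/=; under eq_bigr do rewrite -mulr_sumr hE.
have updi a : upd x k a i0 = x i0 by rewrite /upd eq_sym (negbTE ki).
rewrite (bigD1 (x i0))//= big1 => [|a ax]; last first.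
  case: forallP => [/(_ k)|]; last by rewrite mulr0.
  by rewrite kK updi {1}/upd eqxx (negbTE ax).
rewrite addr0 updi.
have -> : [forall i in K, upd x k (x i0) i == x i0] =
          [forall i in K :\ k, x i == x i0].
  apply: eq_forallb => i; rewrite !inE /upd; case: (eqVneq i k) => [->|ik]//=.
  by rewrite eqxx implybT.
by case: ifP => //; rewrite mulr0.
Qed.

End PartitionRank.

(** * The indicator of zero-sum tuples *)

Section ZeroSum.
Import mathcomp.boot.fintype mathcomp.boot.finset.

Lemma prod_comp_expn (S : comNzRingType) (K I : finType) (g : K -> I) (a : I -> S) :
  \prod_k a (g k) = \prod_b a b ^+ #|[set k | g k == b]|.
Proof.
rewrite (partition_big g predT)//=; apply: eq_bigr => b _.
rewrite -prodr_const; apply: eq_big => [k|k /eqP -> //].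
by rewrite inE.
Qed.

(** Expansion of 1 - (sum)^m into monomials of degree at most m.  When r picks a
    representative of each block of a partition of I, this is the form taken by
    the sum on tuples that are constant on the blocks; only the variables indexed
    by representatives occur. *)
Lemma one_sub_pow_expand (S : comNzRingType) (I : finType) (m : nat) (r : I -> I) :
  exists (O : finType) (sg : O -> S) (e : O -> I -> nat),
  [/\ forall o, (\sum_b e o b <= m)%N,
      forall o b, b \notin r @: setT -> e o b = 0%N &
      forall a : I -> S,
        1 - (\sum_i a (r i)) ^+ m = \sum_o sg o * \prod_b a b ^+ e o b].
Proof.
exists (unit + {ffun 'I_m -> I})%type, (fun o => if o is inl _ then 1 else -1).
exists (fun o b => if o is inr w
  then #|[set k | r ((w : {ffun 'I_m -> I}) k) == b]| else 0%N).
split=> [[[]|w]|[//|w] b br|a].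
- by rewrite big1.
- rewrite -[leqRHS](card_ord m) -sum1_card.
  rewrite (partition_big (fun k => r (w k)) predT)//=.
  by apply: leq_sum => b _; rewrite sum1dep_card.
- apply/eqP; rewrite cards_eq0; apply/eqP/setP => k; rewrite !inE.
  by apply/eqP => kb; rewrite -kb imset_f in br.
rewrite big_sumType/= (big_pred1 tt)/=; last by case.
congr (_ + _); first by rewrite mul1r big1.
under [RHS]eq_bigr do rewrite mulN1r.
rewrite sumrN; congr (- _).
rewrite -[in LHS](card_ord m) -prodr_const bigA_distr_bigA.
by apply: eq_bigr => w _; rewrite -(prod_comp_expn (fun k => r (w k))).
Qed.

Lemma pigeonhole_sum (I : finType) (B : {set I}) (f : I -> nat) (N : nat) :
  B != set0 -> (\sum_(b in B) f b <= N)%N ->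
  exists2 b, b \in B & (#|B| * f b <= N)%N.
Proof.
case/set0Pn => b0 b0B fN.
case: (arg_minnP f b0B) => b bB bmin; exists b => //.
by apply: leq_trans fN; rewrite -sum_nat_const; apply: leq_sum => i; apply: bmin.
Qed.

Lemma expf_card_pred (F : finFieldType) (y : F) : y != 0 -> y ^+ #|F|.-1 = 1.
Proof.
move=> y0; apply: (mulfI y0).
by rewrite -exprS mulr1 prednK ?finfield.expf_card// ltnW// card_finNzRing_gt1.
Qed.

Lemma zero_sum_indicatorE (F : finFieldType) (J : finType) (y : J -> F) :
  [forall c, y c == 0]%:R = \prod_c (1 - y c ^+ #|F|.-1).
Proof.
case: forallP => [h|/forallP].
  rewrite big1// => c _; rewrite (eqP (h c)) expr0n -subn1 subn_eq0.
  by rewrite leqNgt card_finNzRing_gt1 subr0.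
by case/forallPn => c yc; rewrite (bigD1 c)//= expf_card_pred// subrr mul0r.
Qed.

Variables (F : finFieldType) (I J T : finType) (v : T -> J -> F) (r : I -> I).
Local Notation m := #|F|.-1.
Local Notation reps := (r @: setT).

(** The partition of the variables is encoded by the map r that sends an index to
    the representative of its block.  Every monomial of the expanded indicator is
    assigned to a block b in which its degree is at most the average over the
    blocks.  Monomials with the same b and the same exponents of the variable b
    share the factor f, which involves the variables of the block b only; the
    rest, summed up, is g.  The condition
    that the tuple is constant on blocks splits likewise. *)
Lemma zero_sum_decomposition :
  (forall a c, v a c != 0) -> (forall i, r (r i) = r i) -> (1 < #|reps|)%N ->
  let B := setX reps (bounded_exps J m #|reps|) in
  exists h : I * {ffun J -> 'I_m} -> (I -> T) -> F,
  (forall l, l \in B -> decomposable setT (h l)) /\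
  forall x, \sum_(l in B) h l x =
    ([forall i, x (r i) == x i] && [forall c, \sum_i v (x i) c == 0])%:R.
Proof.
move=> v0 rr reps1 B.
have m0 : (0 < m)%N by rewrite -subn1 subn_gt0 card_finNzRing_gt1.
(* Exponents may be reduced modulo q - 1 since the entries are nonzero. *)
have vm a c n : v a c ^+ (n %% m) = v a c ^+ n.
  rewrite [in RHS](divn_eq n m) exprD mulnC exprM.
  by rewrite expf_card_pred// expr1n mul1r.
have [ O [sg [e [em e0 eE]]]] := one_sub_pow_expand F m r.
have /choice [pk pkP] (phi : {ffun J -> O}) : exists b, b \in reps /\
    (#|reps| * \sum_c e (phi c) b <= m * #|J|)%N.
  have [||b bB hb] :=
    @pigeonhole_sum I reps (fun b => \sum_c e (phi c) b)%N (m * #|J|)%N.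
  - by rewrite -card_gt0 ltnW.
  - rewrite exchange_big/= mulnC -sum_nat_const; apply: leq_sum => c _.
    apply: leq_trans (em (phi c)).
    by rewrite [leqRHS](bigID (mem reps))/= leq_addr.
  by exists b.
pose al (phi : {ffun J -> O}) b : {ffun J -> 'I_m} :=
  [ffun c => Ordinal (ltn_pmod (e (phi c) b) m0)].
pose key phi := (pk phi, al phi (pk phi)).
pose f (l : I * {ffun J -> 'I_m}) (x : I -> T) : F :=
  [forall i, (r i == l.1) ==> (x (r i) == x i)]%:R * \prod_c v (x l.1) c ^+ l.2 c.
pose g (l : I * {ffun J -> 'I_m}) (x : I -> T) : F :=
  [forall i, (r i != l.1) ==> (x (r i) == x i)]%:R *
  \sum_(phi | key phi == l) \prod_c (sg (phi c) *
     \prod_(b | (b \in reps) && (b != l.1)) v (x b) c ^+ e (phi c) b).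
have repsP b : b \in reps -> r b = b by case/imsetP => i _ ->.
exists (fun l x => f l x * g l x); split.
  move=> [b alp]; rewrite !inE/= => /andP[bB _].
  exists [set i | r i == b], [set i | r i != b], (f (b, alp)), (g (b, alp)).
  split.
  - by apply/set0Pn; exists b; rewrite inE repsP.
  - have [b' b'B bb'] : exists2 b', b' \in reps & b' != b.
      have /card_gt0P[b'] : (0 < #|reps :\ b|)%N by rewrite (cardsD1 b) bB in reps1.
      by rewrite !inE => /andP[? ?]; exists b'.
    by apply/set0Pn; exists b'; rewrite inE repsP.
  - by rewrite -setI_eq0; apply/eqP/setP => i; rewrite !inE andbN.
  - exact: subsetT.
  split => // x y xy; rewrite /f /g/=.
  - have xyb : x b = y b by apply: xy; rewrite inE repsP.
    rewrite xyb; congr ((nat_of_bool _)%:R * _); apply: eq_forallb => i.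
    by case: eqP => //= ib; rewrite ib xyb xy// inE ib.
  - congr ((nat_of_bool _)%:R * _).
      apply: eq_forallb => i; case: (eqVneq (r i) b) => //= ib.
      by rewrite !xy// !inE// rr.
    apply: eq_bigr => phi _; apply: eq_bigr => c _; congr (_ * _).
    by apply: eq_bigr => b' /andP[b'B bb']; rewrite xy// inE repsP.
move=> x.
rewrite -mulnb natrM zero_sum_indicatorE.
case: (boolP [forall i, _]) => [/forallP xr|xr]; last first.
  rewrite mul0r big1// => -[b alp] _; rewrite /f /g/=.
  have [i xi] := forallPn xr.
  have [ib|ib] := eqVneq (r i) b.
    rewrite (_ : [forall i, (r i == b) ==> _] = false) ?mul0r//.
    by apply/negbTE/forallPn; exists i; rewrite negb_imply ib eqxx -ib.
  rewrite (_ : [forall i, (r i != b) ==> _] = false) ?mul0r ?mulr0//.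
  by apply/negbTE/forallPn; exists i; rewrite negb_imply ib.
have -> : \prod_c (1 - (\sum_i v (x i) c) ^+ m) =
    \sum_(phi : {ffun J -> O})
      \prod_c (sg (phi c) * \prod_b v (x b) c ^+ e (phi c) b).
  transitivity (\prod_c \sum_o sg o * \prod_b v (x b) c ^+ e o b).
    apply: eq_bigr => c _; rewrite -(eE (fun b => v (x b) c)).
    by congr (1 - _ ^+ _); apply: eq_bigr => i _; rewrite (eqP (xr i)).
  by rewrite bigA_distr_bigA.
rewrite mul1r (partition_big key (mem B))/=; last first.
  move=> phi _; have [pB pS] := pkP phi.
  rewrite !inE/= pB; apply: leq_trans pS; rewrite leq_mul2l; apply/orP; right.
  by apply: leq_sum => c _; rewrite ffunE/= leq_mod.
apply: eq_bigr => -[b alp] _; rewrite /f /g/=.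
have -> : [forall i, (r i == b) ==> (x (r i) == x i)].
  by apply/forallP => i; rewrite xr implybT.
have -> : [forall i, (r i != b) ==> (x (r i) == x i)].
  by apply/forallP => i; rewrite xr implybT.
rewrite !mul1r mulr_sumr; apply: eq_bigr => phi /eqP [pb pal].
rewrite -big_split/=; apply: eq_bigr => c _.
rewrite [in RHS](bigD1 b)//= -pal ffunE/= vm pb mulrCA; congr (_ * (_ * _)).
rewrite [RHS](bigID (mem reps))/= [X in _ * X]big1 ?mulr1 => [|b']; last first.
  by case/andP => _ /e0 ->.
by apply: eq_bigl => b'; rewrite andbC.
Qed.

End ZeroSum.

(** * Zero-sum-free families of nowhere zero vectors *)

Section NowhereZero.
Import mathcomp.boot.fintype mathcomp.boot.finset.

(** The indicator of zero-sum tuples is the diagonal tensor with entries 1, as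
    constant tuples have sum |I| x = 0. *)
Theorem card_zero_sum_only_constant (F : finFieldType) (I J T : finType)
    (v : T -> J -> F) :
  (forall a c, v a c != 0) -> (1 < #|I|)%N -> #|I|%:R = 0 :> F ->
  (forall x : I -> T, (forall c, \sum_i v (x i) c = 0) -> forall i j, x i = x j) ->
  (#|T| <= #|I| * #|bounded_exps J #|F|.-1 #|I| |)%N.
Proof.
move=> v0 I1 I0 const.
have idI : [set id i | i in [set: I]] = [set: I] by rewrite imset_id.
have /card_gt0P[i0 _] : (0 < #|I|)%N by exact: ltnW.
have [||h [hdec hE]] := @zero_sum_decomposition F I J T v id v0.
- by [].
- by rewrite idI cardsT.
rewrite idI cardsT in hdec hE.
have := partition_rank_diagonal (in_setT i0) hdec (c := fun=> 1).
rewrite (_ : [set a | _] = [set: T]); last by apply/setP => a; rewrite !inE oner_eq0.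
rewrite cardsX !cardsT; apply=> x; rewrite hE.
have -> : [forall i, x i == x i] by apply/forallP.
have -> : [forall i in [set: I], x i == x i0] = [forall c, \sum_i v (x i) c == 0].
  apply/forallP/forallP => [e c|e i]; last first.
    by apply/implyP => _; apply/eqP/const => c; apply/eqP.
  rewrite (eq_bigr (fun=> v (x i0) c)) => [|i _].
    by rewrite sumr_const -mulr_natr I0 mulr0.
  by have := e i; rewrite inE => /eqP ->.
by case: ifP.
Qed.

(** A partition of {0, ..., k - 1} is the list that gives for each element the
    least element of its block: the last element either joins an earlier block or
    opens a new one.  Facts about all partitions of five elements can then be
    checked by evaluation. *)
Fixpoint set_partitions (k : nat) : seq (seq nat) :=
  if k is k'.+1
  then [seq rcons s j | s <- set_partitions k', j <- undup s ++ [:: k']]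
  else [:: [::]].

Definition blocks (s : seq nat) : nat := size (undup s).

(** The Moebius function of the partition lattice between the discrete partition
    and s: a block of size k contributes (-1)^(k-1) (k-1)!. *)
Definition moebius (s : seq nat) : int :=
  foldr (fun j m => (-1) ^+ (count_mem j s).-1 * ((count_mem j s).-1)`!%:Z * m) 1
    (undup s).

Definition partitions5 := [seq s <- set_partitions 5 | (3 <= blocks s)%N].

Definition constant_on (s ks : seq nat) :=
  all (fun i => nth 0%N ks (nth 0%N s i) == nth 0%N ks i) (iota 0 5).

Definition moebius_sum (ks : seq nat) : int :=
  foldr +%R 0 [seq moebius s * (constant_on s ks)%:Z | s <- partitions5].

(** Over all partitions finer than ks the Moebius values add up to zero, unless
    ks is discrete.  If ks has at least three blocks, so do these partitions, and
    the sum is complete.  If ks has one block, the omitted values are 24, for the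
    single partition with one block, and -50 in total for those with two.  The
    finitely many lists with ks_i <= i are checked by computation. *)
Lemma moebius_sum_values (ks : seq nat) :
  size ks = 5%N -> (forall i, (i < 5)%N -> (nth 0%N ks i <= i)%N) ->
  (blocks ks = 1%N -> moebius_sum ks = 26) /\
  ((2 < blocks ks < 5)%N -> moebius_sum ks = 0).
Proof.
pose ok ks := ((blocks ks == 1%N) ==> (moebius_sum ks == 26)) &&
              ((2 < blocks ks < 5)%N ==> (moebius_sum ks == 0)).
have allok : all (fun b => all (fun c => all (fun d => all (fun e =>
    ok [:: 0%N; b; c; d; e]) (iota 0 5)) (iota 0 4)) (iota 0 3)) (iota 0 2).
  by vm_compute.
case: ks => [//|a [//|b [//|c [//|d [//|e [|//]]]]]] _ h.
have mem i k : (k <= i)%N -> k \in iota 0 i.+1 by rewrite mem_iota.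
move: allok => /allP/(_ _ (mem _ _ (h 1 isT)))/allP/(_ _ (mem _ _ (h 2 isT))).
move=> /allP/(_ _ (mem _ _ (h 3 isT)))/allP/(_ _ (mem _ _ (h 4 isT)))/=.
have /eqP -> : a == 0%N by rewrite -leqn0; apply: (h 0).
case/andP=> /implyP h1 /implyP h2; split=> [/eqP /h1 /eqP //|/h2 /eqP //].
Qed.

Lemma partitions5_wf (s : seq nat) : s \in partitions5 ->
  [/\ size s = 5%N, all (gtn 5) s, (3 <= blocks s)%N &
      forall i, (i < 5)%N -> nth 0%N s (nth 0%N s i) = nth 0%N s i].
Proof.
have : all (fun s => [&& size s == 5%N, all (gtn 5) s, (3 <= blocks s)%N &
    constant_on s s]) partitions5 by vm_compute.
move=> /allP h /h /and4P[/eqP ? ? ? /allP c]; split=> // i i5.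
by apply/eqP/c; rewrite mem_iota.
Qed.

(** This is 25 * 3 + 10 * 4 + 1 * 5, with the Stirling numbers of the second
    kind as multiplicities. *)
Lemma sum_blocks_partitions5 :
  (\sum_(i < size partitions5) blocks (nth [::] partitions5 i) = 120)%N.
Proof.
rewrite -(big_mkord xpredT (fun i => blocks (nth [::] partitions5 i))).
rewrite -(big_nth [::] xpredT blocks) -(big_map blocks xpredT id) -sumnE.
by vm_compute.
Qed.


Definition rep5 (s : seq nat) (i : 'I_5) : 'I_5 := inord (nth 0%N s i).

Lemma val_rep5 (s : seq nat) i : s \in partitions5 -> rep5 s i = nth 0%N s i :> nat.
Proof.
move=> /partitions5_wf[s5 /allP slt _ _]; rewrite inordK//.
by apply: slt; rewrite mem_nth// s5.
Qed.

Lemma rep5_idem (s : seq nat) i : s \in partitions5 -> rep5 s (rep5 s i) = rep5 s i.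
Proof.
move=> sp; have [_ _ _ idem] := partitions5_wf sp.
by apply: val_inj; rewrite /= !val_rep5// idem.
Qed.

Lemma card_rep5 (s : seq nat) : s \in partitions5 ->
  #|[set rep5 s i | i in [set: 'I_5]]| = blocks s.
Proof.
move=> sp; have [s5 slt _ _] := partitions5_wf sp.
have sE : map val (codom (rep5 s)) = s.
  rewrite codomE -map_comp; apply: (@eq_from_nth _ 0%N) => [|i].
    by rewrite size_map size_enum_ord.
  rewrite size_map size_enum_ord => i5.
  by rewrite (nth_map ord0) ?size_enum_ord//= val_rep5// nth_enum_ord.
rewrite /blocks -[in RHS]sE undup_map_inj; last exact: val_inj.
rewrite size_map -(card_uniqP (undup_uniq _)); apply: eq_card => b.
rewrite mem_undup; apply/imsetP/codomP => -[i]; first by move=> _ ->; exists i.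
by move=> ->; exists i.
Qed.

Lemma undup_map_in (A B : eqType) (f : A -> B) (s : seq A) :
  {in s &, injective f} -> undup (map f s) = map f (undup s).
Proof.
elim: s => //= a s IH finj.
have {}IH : undup (map f s) = map f (undup s).
  by apply: IH => b c bs cs; apply: finj; rewrite inE ?bs ?cs orbT.
have -> : (f a \in map f s) = (a \in s).
  apply/mapP/idP => [[b bs /finj -> //]|ass]; last by exists a.
    by rewrite mem_head.
  by rewrite inE bs orbT.
by case: ifP; rewrite IH.
Qed.

Section TupleType.
Variables (T : finType) (x : 'I_5 -> T).
Let values := [seq x (inord i) | i <- iota 0 5].

(** The kernel of a quintuple as a list of positions: each position is sent to the
    first one that carries the same value. *)
Definition kernel5 := [seq index a values | a <- values].

Let nth_kernel5 i j : (i < 5)%N -> (j < 5)%N ->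
  (nth 0%N kernel5 i == nth 0%N kernel5 j) = (x (inord i) == x (inord j)).
Proof.
have vin k : (k < 5)%N -> nth (x ord0) values k = x (inord k).
  by move=> k5; rewrite (nth_map 0%N) ?size_iota// nth_iota.
have memv k : (k < 5)%N -> x (inord k) \in values.
  by move=> k5; apply: map_f; rewrite mem_iota.
move=> i5 j5.
rewrite !(nth_map (x ord0)) ?size_map ?size_iota// !vin//.
apply/eqP/eqP => [|->//] e.
by rewrite -(nth_index (x ord0) (memv i i5)) e nth_index ?memv.
Qed.

Lemma kernel5_wf : size kernel5 = 5%N /\
  forall i, (i < 5)%N -> (nth 0%N kernel5 i <= i)%N.
Proof.
split=> [|i i5]; first by rewrite !size_map size_iota.
by rewrite (nth_map (x ord0)) ?size_map ?size_iota// index_nth ?size_map ?size_iota.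
Qed.

Lemma constant_on_kernel5 (s : seq nat) : s \in partitions5 ->
  constant_on s kernel5 = [forall i, x (rep5 s i) == x i].
Proof.
move=> sp; have [s5 /allP slt _ _] := partitions5_wf sp.
have slt5 i : (i < 5)%N -> (nth 0%N s i < 5)%N.
  by move=> i5; apply: slt; rewrite mem_nth// s5.
apply/allP/forallP => [h i|h i].
  by have := h i; rewrite mem_iota ltn_ord nth_kernel5// ?slt5// inord_val => ->.
rewrite mem_iota => /= i5; rewrite nth_kernel5// ?slt5//.
by have := h (inord i); rewrite /rep5 inordK.
Qed.

Lemma blocks_kernel5 : blocks kernel5 = #|[set x i | i in [set: 'I_5]]|.
Proof.
have -> : #|[set x i | i in [set: 'I_5]]| = size (undup (codom x)).
  rewrite -(card_uniqP (undup_uniq _)); apply: eq_card => a.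
  rewrite mem_undup; apply/imsetP/codomP => -[i]; first by move=> _ ->; exists i.
  by move=> ->; exists i.
have -> : codom x = values.
  rewrite /values codomE -val_enum_ord -map_comp.
  by apply: eq_map => i /=; rewrite inord_val.
rewrite /blocks /kernel5 undup_map_in ?size_map// => a b av bv e.
by rewrite -(nth_index (x ord0) av) e nth_index.
Qed.

End TupleType.

(** If the value a is taken n times and b is taken |I| - n times, the sum is
    n (a - b), and n is invertible since 0 < n < |I|. *)
Lemma zero_sum_not_two_values (F : fieldType) (I J T : finType) (v : T -> J -> F)
    (x : I -> T) :
  #|I| \in [pchar F] -> (forall a b, v a =1 v b -> a = b) ->
  (forall c, \sum_i v (x i) c = 0) -> #|[set x i | i in [set: I]]| != 2%N.
Proof.
move=> pF vinj x0; apply/negP => /cards2P[a [b [ab xE]]].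
have xab i : x i != a -> x i = b.
  by have := imset_f x (in_setT i); rewrite xE !inE => /orP[->//|/eqP].
have [i _ xi] : exists2 i, i \in [set: I] & a = x i.
  by apply/imsetP; rewrite xE !inE eqxx.
have [j _ xj] : exists2 j, j \in [set: I] & b = x j.
  by apply/imsetP; rewrite xE !inE eqxx orbT.
pose n := #|[set i | x i == a]|.
have n0 : (0 < n)%N by apply/card_gt0P; exists i; rewrite inE -xi.
have nI : (n < #|I|)%N.
  rewrite -cardsT; apply/proper_card/properP; split; first exact: subsetT.
  by exists j; rewrite ?inE// -xj eq_sym.
case/eqP: ab; apply: vinj => c; apply/eqP; rewrite -subr_eq0.
have : (v a c - v b c) * n%:R == 0.
  rewrite mulr_natr -sumr_const; apply/eqP.
  transitivity (\sum_k (v (x k) c - v b c)).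
    rewrite big_mkcond/=; apply: eq_bigr => k _; rewrite inE.
    by case: (eqVneq (x k) a) => [->//|/xab ->]; rewrite subrr.
  by rewrite sumrB x0 sumr_const -mulr_natr (pcharf0 pF) mulr0 subr0.
rewrite mulf_eq0 => /orP[//|]; rewrite -(dvdn_pcharf pF) => /(dvdn_leq n0).
by rewrite leqNgt nI.
Qed.

(** The diagonal tensor is the indicator of zero-sum quintuples times the sum of
    the Moebius values of the partitions, with at least three blocks, on whose
    blocks the quintuple is constant.  It takes the value 26 = 1 on the diagonal.
    Off the diagonal a zero-sum quintuple has neither five values, by hypothesis,
    nor two, so it has three or four, and then the Moebius sum is zero. *)
Theorem card_no_distinct_zero_sum (F : finFieldType) (J T : finType)
    (v : T -> J -> F) :
  5 \in [pchar F] -> (forall a c, v a c != 0) -> (forall a b, v a =1 v b -> a = b) ->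
  (forall x : 'I_5 -> T, injective x -> ~ forall c, \sum_i v (x i) c = 0) ->
  (#|T| <= 120 * #|bounded_exps J #|F|.-1 3|)%N.
Proof.
move=> p5 v0 vinj nodist.
pose P (i : 'I_(size partitions5)) := nth [::] partitions5 i.
have Pp i : P i \in partitions5 by apply: mem_nth.
pose reps i := [set rep5 (P i) k | k in [set: 'I_5]].
have cardreps i : #|reps i| = blocks (P i) by apply: card_rep5.
have reps3 i : (3 <= #|reps i|)%N by rewrite cardreps; case: (partitions5_wf (Pp i)).
pose B0 i := setX (reps i) (bounded_exps J #|F|.-1 #|reps i|).
have /choice[h hP] i := zero_sum_decomposition v0 (fun k => rep5_idem k (Pp i))
  (ltnW (reps3 i)).
pose B : {set 'I_(size partitions5) * ('I_5 * {ffun J -> 'I_(#|F|.-1)})} :=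
  [set l | l.2 \in B0 l.1].
have cardB : (#|B| <= 120 * #|bounded_exps J #|F|.-1 3|)%N.
  rewrite -sum_blocks_partitions5 -sum1_card (eq_bigl (fun l => l.2 \in B0 l.1));
    last by move=> l; rewrite inE.
  rewrite -(pair_big_dep xpredT (fun i l => l \in B0 i) (fun _ _ => 1%N))/=.
  rewrite big_distrl/=; apply: leq_sum => i _.
  by rewrite sum1_card cardsX cardreps leq_mul2l -cardreps bounded_exps_sub ?orbT.
apply: leq_trans cardB.
pose h' (l : 'I_(size partitions5) * ('I_5 * {ffun J -> 'I_(#|F|.-1)}))
    (x : 'I_5 -> T) : F :=
  (moebius (P l.1))%:~R * h l.1 l.2 x.
have hdec l : l \in B -> decomposable [set: 'I_5] (h' l).
  rewrite inE => lB; have [/(_ _ lB)] := hP l.1.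
  case=> [Q [Q' [f [g [? ? ? ? [fQ gQ hE]]]]]] _.
  exists Q, Q', (fun x => (moebius (P l.1))%:~R * f x), g; split=> //; split=> //.
    by move=> x y xy; rewrite (fQ x y).
  by move=> x; rewrite /h' hE mulrA.
have hsum x : \sum_(l in B) h' l x =
    (moebius_sum (kernel5 x))%:~R * [forall c, \sum_i v (x i) c == 0]%:R.
  rewrite (eq_bigl (fun l => l.2 \in B0 l.1)); last by move=> l; rewrite inE.
  rewrite -(pair_big_dep xpredT (fun i l => l \in B0 i) (fun i l => h' (i, l) x))/=.
  rewrite /moebius_sum foldrE big_map rmorph_sum/=.
  rewrite (big_nth [::]) big_mkord mulr_suml.
  apply: eq_bigr => i _; rewrite /h'/= -big_distrr/= (hP i).2.
  rewrite (constant_on_kernel5 x (Pp i)).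
  by rewrite intrM -mulnb natrM mulrA.
have := partition_rank_diagonal (in_setT ord0) hdec (c := fun=> 1).
rewrite (_ : [set a | _] = [set: T]); last by apply/setP => a; rewrite !inE oner_eq0.
rewrite cardsT; apply=> x; rewrite hsum.
have [k5 klt] := kernel5_wf x; have [m1 m34] := moebius_sum_values k5 klt.
rewrite blocks_kernel5 in m1 m34.
have F5 : 5%:R = 0 :> F by apply: pcharf0.
case: (boolP [forall i in _, _]) => [/forallP xc|xc].
  have xE i : x i = x ord0 by have := xc i; rewrite inE => /eqP.
  rewrite m1; last first.
    apply/eqP/cards1P; exists (x ord0); apply/setP => a; rewrite inE.
    by apply/imsetP/eqP => [[i _ ->]//|->]; exists ord0.
  have -> : [forall c, \sum_i v (x i) c == 0].
    apply/forallP => c; rewrite (eq_bigr (fun=> v (x ord0) c)) => [|i _].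
      by rewrite sumr_const card_ord -mulr_natr F5 mulr0.
    by rewrite xE.
  rewrite mulr1.
  have -> : (26 : int)%:~R = 5%:R * 5%:R + 1 :> F by rewrite -natrM natr1.
  by rewrite F5 mulr0 add0r.
case: (boolP [forall c, _]) => [/forallP z|_]; last by rewrite mulr0.
have {}z c : \sum_i v (x i) c = 0 by apply/eqP.
rewrite mulr1 m34//.
have not2 : #|[set x i | i in [set: 'I_5]]| != 2%N.
  by apply: zero_sum_not_two_values vinj z; rewrite card_ord.
have not5 : #|[set x i | i in [set: 'I_5]]| != 5%N.
  apply/negP => /eqP card5; case: (@nodist x _ z) => i j.
  have /imset_injP xinj : #|[set x i | i in [set: 'I_5]]| == #|[set: 'I_5]|.
    by rewrite card5 cardsT card_ord.
  exact: xinj.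
have not1 : #|[set x i | i in [set: 'I_5]]| != 1%N.
  apply: contraNN xc => /cards1P[a xE]; apply/forallP => i; apply/implyP => _.
  have xa k : x k = a by apply/eqP; rewrite -in_set1 -xE imset_f.
  by rewrite !xa.
have : (#|[set x i | i in [set: 'I_5]]| <= 5)%N.
  by rewrite (leq_trans (leq_imset_card _ _))// cardsT card_ord.
have : (0 < #|[set x i | i in [set: 'I_5]]|)%N.
  by apply/card_gt0P; exists (x ord0); rewrite imset_f.
by case: #|_| not1 not2 not5 => [|[|[|[|[|[|]]]]]].
Qed.

End NowhereZero.

(** * Reduction to nowhere zero vectors *)

Section Support.
Import mathcomp.boot.fintype mathcomp.boot.finset.

Definition coord_support (F : fieldType) (n : nat) (y : 'rV[F]_n) : {set 'I_n} :=
  [set c | y ord0 c != 0].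

(** The sets with one element less than the whole are the complements of
    singletons. *)
Lemma sum_card_pred (S : comNzRingType) (t : nat) (g : {set 'I_t} -> S) : (0 < t)%N ->
  \sum_(h : {set 'I_t} | #|h| == t.-1) g h = \sum_i g [set~ i].
Proof.
move=> t0; rewrite (reindex_inj (inv_inj (@setCK _)))/=.
rewrite (eq_bigl (mem [set [set i] | i in [set: 'I_t]])) => [|h]; last first.
  rewrite cardsCs setCK card_ord -subn1.
  have ht : (#|h| <= t)%N by rewrite -[X in (_ <= X)%N]card_ord max_card.
  rewrite eqn_sub2lE// inE; apply/cards1P/imsetP => [[i ->]|[i _ ->]]; by exists i.
rewrite big_imset/=; last by move=> i j _ _; apply: set1_inj.
by apply: eq_bigl => i; rewrite inE.
Qed.

(** On nonzero entries e_{t-1} is the product of the entries times the sum of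
    their inverses; outside the common support every term has a zero factor. *)
Lemma esym_pred_eq0 (F : fieldType) (n t : nat) (x : 'I_t -> 'rV[F]_n)
    (S : {set 'I_n}) :
  (1 < t)%N -> (forall i, coord_support (x i) = S) ->
  (forall c, c \in S -> \sum_i (x i ord0 c)^-1 = 0) -> Defs.esym t.-1 x = 0.
Proof.
move=> t1 xS x0; apply/rowP => c; rewrite esymE mxE.
have xc i : (x i ord0 c != 0) = (c \in S) by rewrite -(xS i) inE.
have [cS|cS] := boolP (c \in S); last first.
  apply: big1 => h /eqP ht; have /card_gt0P[i ih] : (0 < #|h|)%N.
    by rewrite ht -subn1 subn_gt0.
  rewrite (bigD1 i)//=; move: (xc i); rewrite (negbTE cS) => /negbFE/eqP ->.
  by rewrite mul0r.
rewrite (sum_card_pred (fun h : {set 'I_t} => \prod_(i in h) x i ord0 c) (ltnW t1)).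
transitivity (\sum_i (\prod_j x j ord0 c) * (x i ord0 c)^-1); last first.
  by rewrite -big_distrr/= x0// mulr0.
apply: eq_bigr => i _; rewrite [in RHS](bigD1 i)//= mulrAC divff ?xc// mul1r.
by apply: eq_bigl => j; rewrite !inE.
Qed.

(** Entrywise inversion on the support S makes the vectors of A with support S
    into the nowhere zero family v indexed by T, with coordinates in J. *)
Section CommonSupport.
Variables (n : nat) (A : {set 'rV['F_5]_n}) (S : {set 'I_n}).

Let T := {y | y \in [set y in A | coord_support y == S]}.
Let J := {c | c \in S}.
Let v (a : T) (c : J) : 'F_5 := (val a ord0 (val c))^-1.

Let TS (a : T) : val a \in A /\ coord_support (val a) = S.
Proof. by have := valP a; rewrite inE => /andP[? /eqP]. Qed.

Let v0 a c : v a c != 0.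
Proof.
have cS : val c \in S := valP c.
by have /setP/(_ (val c)) := (TS a).2; rewrite inE cS invr_eq0.
Qed.

Let vinj a b : v a =1 v b -> a = b.
Proof.
move=> ab; apply/val_inj/rowP => c; have [cS|cS] := boolP (c \in S).
  exact: (invr_inj (ab (exist _ c cS))).
have out (d : T) : val d ord0 c = 0.
  by have /setP/(_ c) := (TS d).2; rewrite inE (negbTE cS) => /negbFE/eqP.
by rewrite !out.
Qed.

Let esym0 (x : 'I_5 -> T) : (forall c, \sum_i v (x i) c = 0) ->
  Defs.esym 4 (fun i => val (x i)) = 0.
Proof.
move=> x0; apply: (@esym_pred_eq0 _ _ 5 _ S) => // [i|c cS]; first exact: (TS _).2.
exact: x0 (exist _ c cS).
Qed.

Let card5 : #|'F_5| = 5%N. Proof. exact: card_Fp. Qed.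

Lemma card_support_strongly_free : strongly_free 5 4 A ->
  (#|[set y in A | coord_support y == S]| <= 5 * #|bounded_exps J 4 5|)%N.
Proof.
move=> Afree; have := @card_zero_sum_only_constant _ 'I_5 J T v v0.
rewrite !card5 card_sig; apply=> //; first exact: pchar_Fp_0.
move=> x /esym0 /Afree xx i j; apply: val_inj; apply: xx => k.
exact: (TS _).1.
Qed.

Lemma card_support_no_distinct :
  (forall x : 'I_5 -> 'rV['F_5]_n, injective x -> (forall i, x i \in A) ->
     Defs.esym 4 x <> 0) ->
  (#|[set y in A | coord_support y == S]| <= 120 * #|bounded_exps J 4 3|)%N.
Proof.
move=> Adist; have := @card_no_distinct_zero_sum 'F_5 J T v (@pchar_Fp 5 isT) v0 vinj.
rewrite card5 card_sig; apply=> // x xinj /esym0; apply: Adist.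
- by move=> i j /val_inj/xinj.
- by move=> i; apply: (TS _).1.
Qed.

End CommonSupport.

Lemma sum_expr_card (S : comNzRingType) (n : nat) (th : S) :
  \sum_(D : {set 'I_n}) th ^+ #|D| = (1 + th) ^+ n.
Proof.
rewrite addrC -[in RHS](card_ord n) -prodr_const bigA_distr.
by apply: eq_bigr => D _; rewrite -big_mkcond/= prodr_const.
Qed.

(** The supports are summed by the identity sum_S c^|S| = (1 + c)^n. *)
Lemma card_le_supports (R : realType) (n d C : nat) (A : {set 'rV['F_5]_n}) :
  (0 < d)%N ->
  (forall S, (#|[set y in A | coord_support y == S]| <=
     C * #|bounded_exps {c | c \in S} 4 d|)%N) ->
  #|A|%:R <= C%:R * (1 + growth_const R 5 d) ^+ n.
Proof.
move=> d0 AS.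
have -> : #|A| = (\sum_(S : {set 'I_n}) #|[set y in A | coord_support y == S]|)%N.
  rewrite -sum1_card (partition_big (@coord_support _ n) xpredT)//=.
  by apply: eq_bigr => S _; rewrite sum1dep_card.
rewrite natr_sum -sum_expr_card mulr_sumr; apply: ler_sum => S _.
apply: le_trans (_ : _ <= (C * #|bounded_exps {c | c \in S} 4 d|)%:R) _.
  by rewrite ler_nat.
rewrite natrM ler_wpM2l//.
by have := @card_bounded_exps_growth R {c | c \in S} 5 d d0; rewrite card_sig.
Qed.

(** Five equal terms form a zero of e_4, because e_4(y, ..., y) = 5 y^4 = 0. *)
Lemma card_fiber_le4 (n k : nat) (s : 'I_k -> 'rV['F_5]_n) (a : 'rV['F_5]_n) :
  (forall f : 'I_5 -> 'I_k, injective f -> Defs.esym 4 (s \o f) <> 0) ->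
  (#|[set i | s i == a]| <= 4)%N.
Proof.
move=> sfree; rewrite leqNgt; apply/negP => card5.
pose f (i : 'I_5) := enum_val (widen_ord card5 i).
have fa i : s (f i) = a by have := enum_valP (widen_ord card5 i); rewrite inE => /eqP.
apply: (sfree f).
  by move=> i j /enum_val_inj e; apply: val_inj; apply: (congr1 val e).
apply: (@esym_pred_eq0 _ _ 5 _ (coord_support a)) => // [i|c cS]; first by rewrite /= fa.
rewrite (eq_bigr (fun=> (a ord0 c)^-1)) => [|i _]; last by rewrite /= fa.
by rewrite sumr_const card_ord -mulr_natr pchar_Fp_0 ?mulr0.
Qed.

Lemma EGZ_free_length_le (R : realType) (n k : nat) (s : 'I_k -> 'rV['F_5]_n) :
  (forall f : 'I_5 -> 'I_k, injective f -> Defs.esym 4 (s \o f) <> 0) ->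
  k%:R <= 480 * (1 + vartheta_q R 5) ^+ n.
Proof.
move=> sfree; pose A := [set s i | i in [set: 'I_k]].
have kA : (k <= 4 * #|A|)%N.
  apply: (leq_trans (_ : k <= \sum_(i < k) 1)%N); first by rewrite sum1_card card_ord.
  rewrite (partition_big s (mem A)) => [|i _]; last exact: imset_f.
  rewrite mulnC -sum_nat_const; apply: leq_sum => a _.
  by rewrite sum1dep_card card_fiber_le4.
have hA : #|A|%:R <= 120%:R * (1 + vartheta_q R 5) ^+ n.
  apply: card_le_supports => // S; apply: card_support_no_distinct => x xinj xA.
  have /choice[f fx] i : exists j, x i = s j by have /imsetP[j _ ->] := xA i; exists j.
  have -> : x = s \o f by apply/funext.
  by apply: sfree => i j ij; apply: xinj; rewrite !fx ij.
apply: le_trans (_ : _ <= (4 * #|A|)%:R) _; first by rewrite ler_nat.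
rewrite natrM; apply: le_trans (ler_wpM2l _ hA) _ => //.
by rewrite mulrA -natrM.
Qed.

End Support.

Lemma EGZ_exists_le (R : realType) (n : nat) :
  exists2 l : nat, is_EGZ 'F_5 5 n 4 l &
    l%:R <= 480 * (1 + vartheta_q R 5) ^+ n + 1.
Proof.
set X := 480 * _.
have X0 : 0 <= X.
  apply: mulr_ge0; first exact: ler0n.
  by apply/exprn_ge0/addr_ge0; [exact: ler01 | exact: growth_const_ge0].
have bnd : EGZ_bound 'F_5 5 n 4 (Num.truncn X).+1.
  move=> k Xk s; apply: contrapT => hs.
  have : k%:R <= X.
    by apply: (@EGZ_free_length_le R n k s) => f finj f0; apply: hs; exists f.
  rewrite leNgt => /negP; apply; apply: lt_le_trans (truncnS_gt X) _.
  by rewrite ler_nat.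
pose P l := `[< EGZ_bound 'F_5 5 n 4 l >].
have exP : exists l, P l by exists (Num.truncn X).+1; apply/asboolP.
case: (ex_minnP exP) => l /asboolP lP lmin.
exists l; first by split=> // l' hl'; apply: lmin; apply/asboolP.
have ll : (l <= (Num.truncn X).+1)%N by apply/lmin/asboolP.
apply: le_trans (_ : _ <= (Num.truncn X).+1%:R) _; first by rewrite ler_nat.
by rewrite -natr1 lerD2r truncn_le.
Qed.

(* The decimals 4.9556902 and 4.2563617 are split into groups of digits, since
   a literal denotes a unary natural number; both are read as values rounded to
   seven decimal places. *)
Theorem theorem1p1 (R : realType) :
  (forall n : nat, (1 <= n)%N ->
    exists2 l : nat, is_EGZ 'F_5 5 n 4 l &
      l%:R <= 480 * (1 + vartheta_q R 5) ^+ n + 1) /\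
  (`|1 + vartheta_q R 5 - (4 + 955 / 10 ^+ 3 + 690 / 10 ^+ 6 + 2 / 10 ^+ 7)|
      <= 5 / 10 ^+ 8 /\
    1 + vartheta_q R 5 < 5) /\
  (forall n : nat, (1 <= n)%N ->
    forall A : {set 'rV['F_5]_n}, strongly_free 5 4 A ->
      #|A|%:R <= 5 * (1 + eta_qp R 5 5) ^+ n) /\
  (`|1 + eta_qp R 5 5 - (4 + 256 / 10 ^+ 3 + 361 / 10 ^+ 6 + 7 / 10 ^+ 7)|
      <= 5 / 10 ^+ 8 /\
    1 + eta_qp R 5 5 < 5).
Proof.
have /andP[v1 v2] := vartheta5_bounds R.
have /andP[e1 e2] := eta55_bounds R.
split; [|split; [|split]].
- by move=> n _; apply: EGZ_exists_le.
- by split; [rewrite ler_norml; apply/andP; split|]; lra.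
- move=> n _ A Afree; apply: card_le_supports; first by [].
  by move=> S; apply: card_support_strongly_free.
- by split; [rewrite ler_norml; apply/andP; split|]; lra.
Qed.
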